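(* There is no mechanism that always selects flows whose net transfers lie in $PO^*$ and that is simultaneously envy-free (satisfies No Envy for the agents on the nodes) and edge-consistent.
   Context: **Problems and flows.** A problem $(G,s,d,u)$ consists of a finite bipartite graph $G=(S\cup D,E)$ with suppliers $S$, demanders $D$ and edges $E\subseteq S\times D$; numbers $s_i\ge 0$ ($i\in S$), $d_j\ge 0$ ($j\in D$); and edge capacities $u_{ij}\in[0,\infty]$. A flow $\varphi=(\varphi_{ij})_{(i,j)\in E}$ has nonnegative entries and induces net transfers $x_i=\sum_{j:(i,j)\in E}\varphi_{ij}$ ($i\in S$) and $y_j=\sum_{i:(i,j)\in E}\varphi_{ij}$ ($j\in D$). It is feasible if $0\le\varphi_{ij}\le u_{ij}$, $x_i\le s_i$ and $y_j\le d_j$ for all $i,j$; $\mathcal F(G,s,d,u)$ denotes the set of feasible flows. **Agents and preferences.** Each node is an agent with a single-peaked preference relation over its own net transfer in $\mathbb R_+$: supplier $i$ has peak $s_i$ and demander $j$ has peak $d_j$ (strict preference strictly increases up to the peak and strictly decreases beyond it). $P_i$ denotes strict preference and $R_i$ weak preference. $\mathcal R^{S\cup D}$ is the set of profiles of single-peaked preferences. **$PO^*$.** Net transfers $(x,y)$ are Pareto optimal if no other net transfers $(x',y')$ induced by a feasible flow make every agent weakly better off and at least one agent strictly better off. $PO^*$ is the set of Pareto optimal net transfers $(x,y)$ with $x\le s$ and $y\le d$. **Mechanisms.** A mechanism (peak-only rule) assigns to every problem $(G,s,d,u)$, where $s,d$ are the agents' peaks, a feasible flow $z$ and the induced net transfers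 $(x,y)$. **No Envy.** The mechanism is envy-free if for every $G,u$, every preference profile $R\in\mathcal R^{S\cup D}$ (with peaks $s,d$) and all $i,j\in S$ with $x_j\,P_i\,x_i$, there are no net transfers $(x',y')$ induced by a flow in $\mathcal F(G,s,d,u)$ with $x'_k=x_k$ for all $k\in S\setminus\{i,j\}$, $y'_l=y_l$ for all $l\in D$, and $x'_i\,P_i\,x_i$; and the analogous condition holds with the roles of suppliers and demanders interchanged. **Edge consistency.** Let $z$ be the flow chosen at $(G,s,d,u)$ and let $(i,j)\in E$. The reduced problem has graph $G'=G\setminus\{(i,j)\}$, $s'_i=s_i-z_{ij}$, $d'_j=d_j-z_{ij}$, all other supplies and demands and the remaining capacities unchanged. The mechanism is edge-consistent if, for every problem and every edge, the flow $z'$ chosen at the reduced problem satisfies $z'_e=z_e$ for every edge $e$ of $G'$. *)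

(* Defs.v *)
From HB Require Import structures.
From mathcomp Require Import all_boot all_order all_algebra.
From mathcomp Require Import reals constructive_ereal.
Set Implicit Arguments.
Unset Strict Implicit.
Unset Printing Implicit Defensive.
Import Order.TTheory GRing.Theory Num.Theory.
Local Open Scope ring_scope.

(* Data carried by edges is indexed by the subtype of edges, so that a problem
   contains no spurious values outside the graph; in particular a problem
   obtained by deleting an edge does not remember its capacity. *)
Notation edge E := {e | e \in E}.

Record problem (R : realType) (S D : finType) := Problem {
  edges : {set S * D};
  supply : S -> R;
  demand : D -> R;
  capacity : edge edges -> \bar R;
  supply_ge0 : forall i, 0 <= supply i;
  demand_ge0 : forall j, 0 <= demand j;
  capacity_ge0 : forall e, (0 <= capacity e)%E }.

Section Flows.
Context {R : realType} {S D : finType}.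
Implicit Type p : problem R S D.

Definition flow p := edge (edges p) -> R.

Definition net_sup p (z : flow p) (i : S) : R :=
  \sum_(e : edge (edges p) | (val e).1 == i) z e.

Definition net_dem p (z : flow p) (j : D) : R :=
  \sum_(e : edge (edges p) | (val e).2 == j) z e.

Record feasible p (z : flow p) : Prop := Feasible {
  feasible_ge0 : forall e, 0 <= z e;
  feasible_cap : forall e, ((z e)%:E <= capacity e)%E;
  feasible_sup : forall i, net_sup z i <= supply p i;
  feasible_dem : forall j, net_dem z j <= demand p j }.

Lemma feasible_edge_sup p (z : flow p) (hz : feasible z) e :
  z e <= supply p (val e).1.
Proof.
apply: le_trans (feasible_sup hz _); rewrite /net_sup (bigD1 e) //= lerDl.
by apply: sumr_ge0 => f _; exact: feasible_ge0 hz f.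
Qed.

Lemma feasible_edge_dem p (z : flow p) (hz : feasible z) e :
  z e <= demand p (val e).2.
Proof.
apply: le_trans (feasible_dem hz _); rewrite /net_dem (bigD1 e) //= lerDl.
by apply: sumr_ge0 => f _; exact: feasible_ge0 hz f.
Qed.

End Flows.

Section Preferences.
Context {R : realType}.

(* [w a b] means that the amount [a] is weakly preferred to [b]; only its
   values on nonnegative amounts are meaningful. *)
Definition preference := R -> R -> Prop.

Definition strict (w : preference) (a b : R) := w a b /\ ~ w b a.

Record single_peaked (peak : R) (w : preference) : Prop := SinglePeaked {
  sp_total : forall a b, 0 <= a -> 0 <= b -> w a b \/ w b a;
  sp_trans : forall a b c, 0 <= a -> 0 <= b -> 0 <= c ->
    w a b -> w b c -> w a c;
  sp_below : forall a b, 0 <= a -> a < b -> b <= peak -> strict w b a;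
  sp_above : forall a b, peak <= a -> a < b -> strict w a b }.

End Preferences.

Record profile (R : realType) (S D : finType) := Profile {
  pref_sup : S -> @preference R;
  pref_dem : D -> @preference R }.

Section Criteria.
Context {R : realType} {S D : finType}.
Implicit Type (p : problem R S D) (r : profile R S D).

Definition single_peaked_profile p r :=
  (forall i, single_peaked (supply p i) (pref_sup r i)) /\
  (forall j, single_peaked (demand p j) (pref_dem r j)).

Definition pareto_dominates r (x' : S -> R) (y' : D -> R)
    (x : S -> R) (y : D -> R) :=
  [/\ forall i, pref_sup r i (x' i) (x i),
      forall j, pref_dem r j (y' j) (y j) &
      (exists i, strict (pref_sup r i) (x' i) (x i)) \/
      (exists j, strict (pref_dem r j) (y' j) (y j))].

Definition pareto_optimal p r (x : S -> R) (y : D -> R) :=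
  (exists z : flow p, [/\ feasible z, net_sup z =1 x & net_dem z =1 y]) /\
  ~ exists z' : flow p,
      feasible z' /\ pareto_dominates r (net_sup z') (net_dem z') x y.

Definition PO_star p r (x : S -> R) (y : D -> R) :=
  [/\ pareto_optimal p r x y,
      forall i, x i <= supply p i &
      forall j, y j <= demand p j].

Definition no_envy p r (z : flow p) :=
  (forall i j : S,
     strict (pref_sup r i) (net_sup z j) (net_sup z i) ->
     ~ exists z' : flow p,
         [/\ feasible z',
             forall k, k != i -> k != j -> net_sup z' k = net_sup z k,
             forall l, net_dem z' l = net_dem z l &
             strict (pref_sup r i) (net_sup z' i) (net_sup z i)]) /\
  (forall i j : D,
     strict (pref_dem r i) (net_dem z j) (net_dem z i) ->
     ~ exists z' : flow p,
         [/\ feasible z',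
             forall k, k != i -> k != j -> net_dem z' k = net_dem z k,
             forall l, net_sup z' l = net_sup z l &
             strict (pref_dem r i) (net_dem z' i) (net_dem z i)]).

Definition keep_edge p (e : edge (edges p))
    (f : edge (edges p :\ val e)) : edge (edges p) :=
  exist _ (val f) (subsetP (subD1set (edges p) (val e)) (val f) (valP f)).

Section Reduced.
Variables (p : problem R S D) (z : flow p) (hz : feasible z).
Variable e : edge (edges p).

Definition reduced_supply (i : S) : R :=
  if i == (val e).1 then supply p i - z e else supply p i.

Definition reduced_demand (j : D) : R :=
  if j == (val e).2 then demand p j - z e else demand p j.

Lemma reduced_supply_ge0 i : 0 <= reduced_supply i.
Proof.
rewrite /reduced_supply; case: eqP => [->|_]; last exact: supply_ge0.
by rewrite subr_ge0; exact: feasible_edge_sup.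
Qed.

Lemma reduced_demand_ge0 j : 0 <= reduced_demand j.
Proof.
rewrite /reduced_demand; case: eqP => [->|_]; last exact: demand_ge0.
by rewrite subr_ge0; exact: feasible_edge_dem.
Qed.

Definition reduced : problem R S D :=
  @Problem R S D (edges p :\ val e) reduced_supply reduced_demand
    (fun f => capacity (keep_edge f))
    reduced_supply_ge0 reduced_demand_ge0
    (fun f => capacity_ge0 (keep_edge f)).

End Reduced.

End Criteria.

(* The rule only sees the problem, hence only the peaks of the preferences. *)
Record mechanism (R : realType) := Mechanism {
  rule : forall (S D : finType) (p : problem R S D), flow p;
  rule_feasible : forall (S D : finType) (p : problem R S D),
    feasible (@rule S D p) }.

Arguments rule {R} m {S D} p e.
Arguments rule_feasible {R} m {S D} p.

Definition selects_PO_star (R : realType) (m : mechanism R) :=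
  forall (S D : finType) (p : problem R S D) (r : profile R S D),
    single_peaked_profile p r ->
    PO_star p r (net_sup (rule m p)) (net_dem (rule m p)).

Definition envy_free (R : realType) (m : mechanism R) :=
  forall (S D : finType) (p : problem R S D) (r : profile R S D),
    single_peaked_profile p r -> no_envy r (rule m p).

Definition edge_consistent (R : realType) (m : mechanism R) :=
  forall (S D : finType) (p : problem R S D) (e : edge (edges p))
    (f : edge (edges p :\ val e)),
    rule m (reduced (rule_feasible m p) e) f = rule m p (keep_edge f).

(* Main.v *)
Require Import Defs.
From mathcomp Require Import all_boot all_order all_algebra.
From mathcomp Require Import reals constructive_ereal.
From mathcomp Require Import lra.

(** Two suppliers share a demander [A], and one of them, the hub, is alone in
    serving a second demander [B]:

<<
      hub ----- B
         \
          \
    rim ----- A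
>>

    Each supply is 2, each demand is 1, and capacities are infinite.  Pareto
    optimality makes both demands met, so the hub sends 1 to [B].  Were it also
    to send [t > 0] to [A], the rim would receive [1 - t], envy the [1 + t] of
    the hub, and could be given more at the hub's expense; hence the hub sends
    nothing to [A] and the rim sends 1.

    Deleting the edge from the hub to [B] makes the problem forget that the hub
    has traded.  What remains is one demander with demand 1 and two suppliers
    with supplies 1 and 2.  Edge consistency keeps the flow 0 from the hub and
    1 from the rim, so now the hub envies the rim, and splitting the demand
    equally would make the hub better off.

    The two axioms on net transfers are used only through their consequences
    [PO_star_maximal] and [envy_free_sup_le], obtained from one particular
    preference profile, the distance to the peak. *)

Set Implicit Arguments.
Unset Strict Implicit.
Unset Printing Implicit Defensive.
Import Order.TTheory GRing.Theory Num.Theory.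
Local Open Scope ring_scope.

(** * Distance preferences *)

Section Distance.
Context {R : realType}.

Definition distance_preference (peak : R) : preference :=
  fun a b => `|a - peak| <= `|b - peak|.

Lemma distance_lt_strict (peak a b : R) :
  `|a - peak| < `|b - peak| -> strict (distance_preference peak) a b.
Proof.
by move=> lt_ab; split; [exact: ltW | apply/negP; rewrite -ltNge].
Qed.

Lemma distance_below (peak a b : R) :
  a < b -> b <= peak -> strict (distance_preference peak) b a.
Proof.
by move=> ab bp; apply: distance_lt_strict; rewrite !ler0_norm; lra.
Qed.

Lemma distance_single_peaked (peak : R) :
  single_peaked peak (distance_preference peak).
Proof.
split=> [a b _ _ | a b c _ _ _ | a b _ | a b pa ab].
- by apply/orP; exact: le_total.
- exact: le_trans.
- exact: distance_below.
- by apply: distance_lt_strict; rewrite !ger0_norm; lra.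
Qed.

Definition distance_profile {S D : finType} (p : problem R S D) :
    profile R S D :=
  Profile (fun i => distance_preference (supply p i))
          (fun j => distance_preference (demand p j)).

Lemma distance_profileP {S D : finType} (p : problem R S D) :
  single_peaked_profile p (distance_profile p).
Proof. by split=> ?; exact: distance_single_peaked. Qed.

End Distance.

(** * Consequences of the axioms for net transfers *)

Section Consequences.
Context {R : realType} {S D : finType}.
Variables (m : mechanism R) (p : problem R S D).
Let z := rule m p.
Let hz := rule_feasible m p.

(** All transfers of a feasible flow are on the increasing side of the
    preferences, so an increase anywhere would be a Pareto improvement. *)
Lemma PO_star_maximal (z' : flow p) :
    selects_PO_star m -> feasible z' ->
    (forall i, net_sup z i <= net_sup z' i) ->
    (forall j, net_dem z j <= net_dem z' j) ->
  net_sup z' =1 net_sup z /\ net_dem z' =1 net_dem z.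
Proof.
move=> PO hz' sup_le dem_le.
have [[_ undominated] _ _] := PO _ _ _ _ (distance_profileP p).
have no_gain : ~ ((exists i, strict (distance_preference (supply p i))
                               (net_sup z' i) (net_sup z i)) \/
                  (exists j, strict (distance_preference (demand p j))
                               (net_dem z' j) (net_dem z j))).
  move=> gain; apply: undominated; exists z'; split=> //.
  have weak peak a b : a <= b -> b <= peak -> distance_preference peak b a.
    by move=> ab bp; rewrite /distance_preference !ler0_norm; lra.
  split=> // k; apply: weak => //; [exact: feasible_sup | exact: feasible_dem].
split=> k; apply/eqP; rewrite eq_le.
- rewrite sup_le andbT leNgt; apply/negP => lt_k; apply: no_gain; left.
  by exists k; exact: distance_below lt_k (feasible_sup hz' k).
- rewrite dem_le andbT leNgt; apply/negP => lt_k; apply: no_gain; right.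
  by exists k; exact: distance_below lt_k (feasible_dem hz' k).
Qed.

(** Between the transfer of [i] and its peak, more is better: if [i] could
    still gain at the expense of [j] alone, then [i] envies [j] as soon as [j]
    has more. *)
Lemma envy_free_sup_le (i j : S) (z' : flow p) :
    envy_free m -> feasible z' ->
    (forall k, k != i -> k != j -> net_sup z' k = net_sup z k) ->
    (forall l, net_dem z' l = net_dem z l) ->
    net_sup z i < net_sup z' i -> net_sup z j <= supply p i ->
  net_sup z j <= net_sup z i.
Proof.
move=> EF hz' sup_eq dem_eq gain j_le; rewrite leNgt; apply/negP => envy.
have [no_envy_sup _] := EF _ _ _ _ (distance_profileP p).
apply: (no_envy_sup i j); first exact: distance_below.
by exists z'; split=> //; exact: distance_below gain (feasible_sup hz' i).
Qed.

End Consequences.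

(** * Flows as functions on all pairs *)

(** Deleting an edge changes the type of flows, while one function on
    [S * D] can represent both a flow and its restriction; the extension by 0
    serves to compare them. *)
Section Extension.
Context {R : realType} {S D : finType}.
Implicit Type p : problem R S D.

Definition extend p (z : flow p) (x : S * D) : R :=
  if insub x is Some e then z e else 0.

Lemma extend_val p (z : flow p) e : z e = extend z (val e).
Proof. by rewrite /extend valK. Qed.

Lemma net_sup_pairs p (z : flow p) (f : S * D -> R) i :
    (forall e, z e = f (val e)) ->
  net_sup z i = \sum_(j | (i, j) \in edges p) f (i, j).
Proof.
move=> zf; rewrite /net_sup (eq_bigr _ (fun e _ => zf e)).
rewrite -(big_sub_cond (edges p) (fun x : S * D => x.1 == i) f).
transitivity (\sum_(a | a == i) \sum_(j | (a, j) \in edges p) f (a, j));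
  last exact: big_pred1_eq.
rewrite pair_big_dep.
by apply: eq_big => -[a b] //=; rewrite andbC.
Qed.

Lemma net_dem_pairs p (z : flow p) (f : S * D -> R) j :
    (forall e, z e = f (val e)) ->
  net_dem z j = \sum_(i | (i, j) \in edges p) f (i, j).
Proof.
move=> zf; rewrite /net_dem (eq_bigr _ (fun e _ => zf e)).
rewrite -(big_sub_cond (edges p) (fun x : S * D => x.2 == j) f).
transitivity (\sum_(b | b == j) \sum_(i | (i, b) \in edges p) f (i, b));
  last exact: big_pred1_eq.
rewrite (exchange_big_dep xpredT) //= pair_big_dep.
by apply: eq_big => -[a b] //=; rewrite andbC.
Qed.

End Extension.

(** * The example *)

Section Example.
Context {R : realType}.

(** As a supplier, [true] is the hub and [false] the rim; as a demander, [true]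
    is [A] and [false] is [B]. *)
Definition hub_problem : problem R bool bool :=
  @Problem R bool bool [set x | x.1 || x.2]
    (fun=> 2) (fun=> 1) (fun=> +oo%E)
    (fun=> ler0n _ 2) (fun=> ler01) (fun=> le0y).

Fact hub_B_in : (true, false) \in edges hub_problem.
Proof. by rewrite inE. Qed.

Definition hub_B : edge (edges hub_problem) := exist _ (true, false) hub_B_in.

(** Amounts from the hub to [A] and [B] and from the rim to [A]; the pair from
    the rim to [B] is not an edge, so its value is immaterial. *)
Definition amounts (a b c : R) (x : bool * bool) : R :=
  if x.1 then (if x.2 then a else b) else c.

Lemma hub_net (z : flow hub_problem) (f : bool * bool -> R) :
    (forall e, z e = f (val e)) ->
  [/\ net_sup z true = f (true, true) + f (true, false),
      net_sup z false = f (false, true),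
      net_dem z true = f (true, true) + f (false, true) &
      net_dem z false = f (true, false)].
Proof.
move=> zf; split; rewrite (net_sup_pairs _ zf, net_dem_pairs _ zf) big_mkcond;
  by rewrite big_bool !inE /= ?addr0.
Qed.

Lemma hub_feasible (z : flow hub_problem) (f : bool * bool -> R) :
    (forall e, z e = f (val e)) -> (forall x, 0 <= f x) ->
    f (true, true) + f (true, false) <= 2 -> f (false, true) <= 2 ->
    f (true, true) + f (false, true) <= 1 -> f (true, false) <= 1 ->
  feasible z.
Proof.
move=> zf f_ge0 le_hub le_rim le_A le_B.
have [sup_hub sup_rim dem_A dem_B] := hub_net zf.
split=> [e | e | [] | []] /=; rewrite ?leey ?zf //.
- by rewrite sup_hub.
- by rewrite sup_rim.
- by rewrite dem_A.
- by rewrite dem_B.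
Qed.

Section Rule.
Variable m : mechanism R.
Let z := rule m hub_problem.
Let hz := rule_feasible m hub_problem.
Let f := extend z.

Let zf e : z e = f (val e). Proof. exact: extend_val. Qed.

Let f_ge0 x : x \in edges hub_problem -> 0 <= f x.
Proof. by move=> xE; have := feasible_ge0 hz (exist _ x xE); rewrite -/z zf. Qed.

(** Keeping the transfer from the hub to [A] and topping up both demands is
    feasible and lowers no net transfer. *)
Lemma hub_demands_met : selects_PO_star m ->
  f (true, true) + f (false, true) = 1 /\ f (true, false) = 1.
Proof.
move=> PO; have [sup_hub sup_rim dem_A dem_B] := hub_net zf.
have := feasible_dem hz false; rewrite dem_B /= => le_B.
have := feasible_dem hz true; rewrite dem_A /= => le_A.
have hubA : 0 <= f (true, true) by apply: f_ge0; rewrite inE.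
have rimA : 0 <= f (false, true) by apply: f_ge0; rewrite inE.
pose g := amounts (f (true, true)) 1 (1 - f (true, true)).
pose z' : flow hub_problem := fun e => g (val e).
have z'g e : z' e = g (val e) by [].
have hz' : feasible z'.
  by apply: (hub_feasible z'g) => [[[] []]|||| ]; rewrite /g /amounts /=; lra.
have [sup_hub' sup_rim' dem_A' dem_B'] := hub_net z'g.
have [_ dem_eq] : net_sup z' =1 net_sup z /\ net_dem z' =1 net_dem z.
  apply: PO_star_maximal => // -[].
  - by rewrite sup_hub sup_hub' /g /amounts /=; lra.
  - by rewrite sup_rim sup_rim' /g /amounts /=; lra.
  - by rewrite dem_A dem_A' /g /amounts /=; lra.
  - by rewrite dem_B dem_B' /g /amounts /=; lra.
split; [move: (dem_eq true) | move: (dem_eq false)].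
- by rewrite dem_A dem_A' /g /amounts /=; lra.
- by rewrite dem_B dem_B' /g /amounts /=; lra.
Qed.

(** The exclusive trade with [B] already gives the hub as much as the rim can
    get, so fairness leaves the whole of [A] to the rim. *)
Lemma hub_flow : selects_PO_star m -> envy_free m ->
  [/\ f (true, true) = 0, f (true, false) = 1 & f (false, true) = 1].
Proof.
move=> PO EF; have [met_A met_B] := hub_demands_met PO.
have [sup_hub sup_rim dem_A dem_B] := hub_net zf.
have := feasible_sup hz true; rewrite sup_hub /= => le_hub.
have hubA_ge0 : 0 <= f (true, true).
  by apply: f_ge0; rewrite inE.
suff hubA : f (true, true) = 0 by split=> //; lra.
apply/eqP; rewrite eq_le hubA_ge0 andbT leNgt; apply/negP => hubA_gt0.
pose g := amounts 0 1 1.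
pose z' : flow hub_problem := fun e => g (val e).
have z'g e : z' e = g (val e) by [].
have hz' : feasible z'.
  by apply: (hub_feasible z'g) => [[[] []]|||| ]; rewrite /g /amounts /=; lra.
have [sup_hub' sup_rim' dem_A' dem_B'] := hub_net z'g.
(* The rim would gain from [z'], so the hub cannot have more than the rim. *)
suff : net_sup z true <= net_sup z false by rewrite sup_hub sup_rim; lra.
apply: (envy_free_sup_le (z' := z')) => //.
- by case.
- by case; rewrite (dem_A, dem_B) (dem_A', dem_B') /g /amounts /=; lra.
- by rewrite sup_rim sup_rim' /g /amounts /=; lra.
- by rewrite sup_hub.
Qed.

Let q := reduced hz hub_B.

Lemma reduced_net (w : flow q) (g : bool * bool -> R) :
    (forall e, w e = g (val e)) ->
  [/\ net_sup w true = g (true, true),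
      net_sup w false = g (false, true),
      net_dem w true = g (true, true) + g (false, true) &
      net_dem w false = 0].
Proof.
move=> wg; split; rewrite (net_sup_pairs _ wg, net_dem_pairs _ wg) big_mkcond;
  by rewrite big_bool !inE /= ?addr0.
Qed.

(** With its trade with [B] erased, the hub is an unfairly treated competitor
    of the rim for [A]. *)
Lemma hub_contradiction :
  selects_PO_star m -> envy_free m -> edge_consistent m -> False.
Proof.
move=> PO EF EC; have [hubA hubB rimA] := hub_flow PO EF.
have wf e : rule m q e = f (val e) by rewrite EC; exact: zf.
have [sup_hub sup_rim dem_A dem_B] := reduced_net wf.
have supply_hub : supply q true = 1.
  by rewrite /= /reduced_supply /= -/z zf hubB; lra.
pose g := amounts 2^-1 0 2^-1.
pose w' : flow q := fun e => g (val e).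
have w'g e : w' e = g (val e) by [].
have [sup_hub' sup_rim' dem_A' dem_B'] := reduced_net w'g.
have hw' : feasible w'.
  split=> [e | e | [] | []].
  - by rewrite w'g /g /amounts; case: ifP => _; [case: ifP => _|]; lra.
  - exact: leey.
  - by rewrite sup_hub' supply_hub /g /amounts /=; lra.
  - by rewrite sup_rim' /= /reduced_supply /= /g /amounts /=; lra.
  - by rewrite dem_A' /= /reduced_demand /= /g /amounts /=; lra.
  - by rewrite dem_B'; exact: demand_ge0.
(* The hub would gain from the equal split, so the rim cannot have more. *)
suff : net_sup (rule m q) false <= net_sup (rule m q) true.
  by rewrite sup_hub sup_rim; lra.
apply: (envy_free_sup_le (z' := w')) => //.
- by case.
- by case; rewrite (dem_A, dem_B) (dem_A', dem_B') /g /amounts //=; lra.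
- by rewrite sup_hub sup_hub' /g /amounts /=; lra.
- by rewrite sup_rim supply_hub; lra.
Qed.

End Rule.
End Example.

Theorem lemma2 (R : realType) :
  ~ exists m : mechanism R,
      [/\ selects_PO_star m, envy_free m & edge_consistent m].
Proof. by case=> m [PO EF EC]; exact: hub_contradiction PO EF EC. Qed.
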